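(* Let $\lambda,\mu>0$, let $n,k\ge 1$ be integers, and put $\alpha=\frac{\lambda}{\lambda+\mu}$. Let $O^{(1)}_{n,n+k}$ and $O^{(2)}_{n,n+k}$ be the overlap times of the $n$-th and $(n+k)$-th customers in stations 1 and 2 of the $(M/M/\infty)^2$ tandem queue with arrival rate $\lambda$ and with both stations having exponential service times of the same rate $\mu$. Then for all $x,y\ge 0$ the marginal tail distributions are $$\mathbb{P}\left(O^{(1)}_{n,n+k}>x\right)=e^{-2\mu x}\alpha^k,$$ $$\mathbb{P}\left(O^{(2)}_{n,n+k}>y\right)=\frac{e^{-2\mu y}}{2}\alpha^k+\frac{e^{-2\mu y}}{2}\,\alpha^k\left(\frac{\mu}{\lambda+\mu}\right)k.$$ Moreover, $$\mathbb{P}\left(O^{(1)}_{n,n+k}\le x,\ O^{(2)}_{n,n+k}\le y\right)=1-\left(\frac{e^{-2\mu y}}{2}+\frac{e^{-2\mu y}}{2}\left(\frac{\mu k}{\lambda+\mu}\right)-\frac{e^{-2\mu(x+y)}}{2}+e^{-2\mu x}\right)\alpha^k,$$ $$\mathbb{P}\left(O^{(1)}_{n,n+k}\le x,\ O^{(2)}_{n,n+k}>y\right)=\left(\frac{e^{-2\mu y}}{2}+\frac{e^{-2\mu y}}{2}\left(\frac{\mu}{\lambda+\mu}\right)k-\frac{e^{-2\mu(x+y)}}{2}\right)\alpha^k,$$ $$\mathbb{P}\left(O^{(1)}_{n,n+k}>x,\ O^{(2)}_{n,n+k}\le y\right)=\left(e^{-2\mu x}-\frac{e^{-2\mu(x+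y)}}{2}\right)\alpha^k.$$
   Context: The $(M/M/\infty)^2$ tandem queue with identically distributed stations: customers $1,2,3,\dots$ arrive at station 1 at the successive points $A_1<A_2<\cdots$ of a Poisson process of rate $\lambda$, so the inter-arrival times $A_{i+1}-A_i$ are i.i.d. exponential with rate $\lambda$. Each station has infinitely many servers; customer $i$ receives service of duration $S^{(1)}_i$ at station 1 starting at time $A_i$, then immediately moves to station 2 and receives service of duration $S^{(2)}_i$. All service times $S^{(j)}_i$ ($j=1,2$, $i\ge 1$) are i.i.d. exponential with rate $\mu$ (mean $1/\mu$) and independent of the arrival process. Put $D^{(0)}_i=A_i$ and $D^{(j)}_i=A_i+\sum_{l=1}^{j}S^{(l)}_i$, the departure time of customer $i$ from station $j$. The overlap time of customers $n$ and $n+k$ in station $j$ is $$O^{(j)}_{n,n+k}=\left(\min\left(D^{(j)}_n,D^{(j)}_{n+k}\right)-\max\left(D^{(j-1)}_n,D^{(j-1)}_{n+k}\right)\right)^+,\qquad j=1,2,$$ where $z^+=\max(z,0)$. *)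

(* Defs.v *)
From HB Require Import structures.
From mathcomp Require Import all_boot all_order all_algebra finmap.
From mathcomp Require Import all_classical all_reals all_analysis.

Set Implicit Arguments.
Unset Strict Implicit.
Unset Printing Implicit Defensive.

Import Order.TTheory GRing.Theory Num.Theory.
Import numFieldNormedType.Exports.

Local Open Scope classical_set_scope.
Local Open Scope ring_scope.

Section probability_notions.
Context (d : measure_display) (T : measurableType d) (R : realType).
Variable P : probability T R.

(* Restricted to Borel sets, because [pushforward] and [exponential_prob] are
   total functions on all subsets of R. *)
Definition exponential_law (rate : R) (X : T -> R) : Prop :=
  forall B : set R, measurable B -> P (X @^-1` B) = exponential_prob rate B.

Definition mutually_independent (I : choiceType) (D : set I)
    (X : I -> T -> R) : Prop :=
  forall (J : {fset I}) (B : I -> set R),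
    [set` J] `<=` D -> (forall i, i \in J -> measurable (B i)) ->
    P (\bigcap_(i in [set` J]) (X i @^-1` B i)) =
    (\prod_(i <- J) P (X i @^-1` B i))%E.

Definition iid_exponential (rate : R) (I : choiceType) (D : set I)
    (X : I -> T -> R) : Prop :=
  mutually_independent D X /\ (forall i, D i -> exponential_law rate (X i)).

Definition sigma_family (I : Type) (D : set I) (X : I -> T -> R) :
    set (set T) :=
  <<s \bigcup_(i in D) g_sigma_algebra_preimage (X i) >>.

Definition independent_families (I : Type) (D : set I) (X : I -> T -> R)
    (I' : Type) (D' : set I') (Y : I' -> T -> R) : Prop :=
  forall E F : set T, sigma_family D X E -> sigma_family D' Y F ->
    P (E `&` F) = (P E * P F)%E.

End probability_notions.

(* Customers are numbered 1, 2, 3, ... and stations 1, 2; the values of the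
   families below at other indices are unconstrained and never used. *)
Definition customers : set nat := [set i | (1 <= i)%N].

Definition stations_customers : set (nat * nat) :=
  [set ji | (1 <= ji.1 <= 2)%N /\ customers ji.2].

Section tandem_queue.
Context (d : measure_display) (T : measurableType d) (R : realType).
Variable P : probability T R.

(* [interarrival A 0] is the time from the origin to the first arrival, and
   [interarrival A i] is A_(i+1) - A_i for i >= 1. *)
Definition interarrival (A : nat -> T -> R) (i : nat) (w : T) : R :=
  A i.+1 w - (if i is 0%N then 0 else A i w).

(* The successive points of a Poisson process on [0, +oo[ as a renewal sequence;
   A_1 < A_2 < ... then holds almost surely. *)
Definition poisson_points (rate : R) (A : nat -> T -> R) : Prop :=
  iid_exponential P rate [set: nat] (interarrival A).

Record MMinf_tandem2 (lambda mu : R) (A : nat -> {RV P >-> R})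
    (S : nat -> nat -> {RV P >-> R}) : Prop := {
  tandem_arrivals : poisson_points lambda (fun i => A i : T -> R);
  tandem_services : iid_exponential P mu stations_customers
    (fun ji => S ji.1 ji.2 : T -> R);
  tandem_independent : independent_families P
    customers (fun i => A i : T -> R)
    stations_customers (fun ji => S ji.1 ji.2 : T -> R) }.

Definition departure (A : nat -> T -> R) (S : nat -> nat -> T -> R)
    (j i : nat) (w : T) : R :=
  A i w + \sum_(1 <= l < j.+1) S l i w.

(* Meaningful for j >= 1. *)
Definition overlap (A : nat -> T -> R) (S : nat -> nat -> T -> R)
    (j n m : nat) (w : T) : R :=
  Num.max
    (Num.min (departure A S j n w) (departure A S j m w) -
     Num.max (departure A S j.-1 n w) (departure A S j.-1 m w)) 0.

End tandem_queue.

(* Main.v *)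
Require Import Defs.
From HB Require Import structures.
From mathcomp Require Import all_boot all_order all_algebra finmap.
From mathcomp Require Import all_classical all_reals all_analysis.
From mathcomp Require Import measurable_realfun.
From mathcomp Require Import ring lra.

Set Implicit Arguments.
Unset Strict Implicit.
Unset Printing Implicit Defensive.

Import Order.TTheory GRing.Theory Num.Theory.
Import numFieldNormedType.Exports.

Local Open Scope classical_set_scope.
Local Open Scope ring_scope.

(** Let [a], [b] be the service times of customer n at stations 1 and 2, [c],
    [e] those of customer n + k, and G = A_(n+k) - A_n the time between their
    arrivals. For x, y >= 0 and G >= 0 the two overlap events are, after
    clearing minima and maxima,
      x < O1  iff  a > G + x and c > x,
      y < O2  iff  b > y + (G + c - a)^+ and e > y + (a - G - c)^+
    ([lt_first_overlap], [lt_second_overlap]).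

    Freeze G = g first. Since b and e are exponential and independent of
    (a, c), the conditional probability of y < O2 given (a, c) is
      exp(-mu (y + (g+c-a)^+)) exp(-mu (y + (a-g-c)^+))
        = exp(-2 mu y) exp(-mu |g+c-a|),
    because u^+ + (-u)^+ = |u|. Integrating this over {a > s, c > r} gives
      exp(-2 mu y) exp(-mu g) exp(-2 mu r) (1 + mu (g+r-s)) / 2
    whenever s <= g + r ([probability_second_overlap]). Taking s = r = 0 yields
    the event y < O2; taking s = g + x and r = x, where the last factor is 1/2,
    yields the joint event x < O1, y < O2. The event x < O1 alone has
    probability exp(-mu (g+x)) exp(-mu x).

    All three are of the form (p g + q) exp(-mu g). As G is independent of the
    service times and is a sum of k independent exponential variables of rate
    lambda, it remains to compute
      E[(p G + q) exp(-mu G)] = alpha^k (q + k p / (lambda + mu)),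
    by induction on k ([expectation_gap]): integrating out one summand turns
    (p, q) into (alpha p, alpha (q + p / (lambda + mu))). The five formulas then
    follow by inclusion and exclusion.

    The measure-theoretic input is that independent variables may be integrated
    out one at a time ([integral_independent_pair]) and that one member of a
    mutually independent family is independent of everything generated by
    other members ([mutually_independent_rest]). *)

(** * Indicators and almost sure events *)

Lemma measurable_fun_natr d (T : measurableType d) (R : realType) (D : set T)
    (b : T -> bool) :
  measurable D -> measurable_fun D b ->
  measurable_fun D (fun x => (b x)%:R : R).
Proof.
move=> mD mb; rewrite (_ : (fun x => _) = (fun x => if b x then 1 else 0)).
  exact: measurable_fun_if.
by apply/funext => x; case: (b x).
Qed.

Ltac solve_measurable := repeat first
  [ exact: measurable_cst | exact: measurable_fst | exact: measurable_snd
  | exact: measurable_id | assumption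
  | apply: measurable_funD | apply: measurable_funB | apply: measurable_funM
  | apply: (measurableT_comp (@oppr_measurable _ _))
  | apply: measurable_maxr | apply: measurable_fun_ltr
  | apply: (measurable_fun_natr measurableT)
  | apply: (measurableT_comp (@measurable_expR _))
  | apply: (measurableT_comp (@normr_measurable _ _))
  | apply: (measurableT_comp measurable_fst)
  | apply: (measurableT_comp measurable_snd)
  | apply: measurable_fun_pair ].

Lemma probability_integral d (T : measurableType d) (R : realType)
    (P : probability T R) (b : T -> bool) : measurable_fun setT b ->
  P [set w | b w] = (\int[P]_w (b w)%:R%:E)%E.
Proof.
move=> mb.
have mE : measurable [set w | b w].
  by rewrite -[X in measurable X]setTI; exact: (mb measurableT [set true]).
rewrite -[X in P X]setIT -integral_indic//; apply: eq_integral => w _.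
by rewrite indicE mem_setE.
Qed.

Lemma integral_ae_true d (T : measurableType d) (R : realType)
    (P : probability T R) (b : T -> bool) (f : T -> R) :
  measurable_fun setT b -> measurable_fun setT f -> (forall w, 0 <= f w) ->
  {ae P, forall w, b w} ->
  (\int[P]_w ((b w)%:R * f w)%:E = \int[P]_w (f w)%:E)%E.
Proof.
move=> mb mf f0 bP; apply: ge0_ae_eq_integral => //.
- by apply/measurable_EFinP; solve_measurable.
- by apply/measurable_EFinP.
- by move=> w _; rewrite lee_fin mulr_ge0.
- by move=> w _; rewrite lee_fin.
by apply: filterS bP => w bw _; rewrite bw mul1r.
Qed.

Lemma probability_ae_eq d (T : measurableType d) (R : realType)
    (P : probability T R) (b1 b2 : T -> bool) :
  measurable_fun setT b1 -> measurable_fun setT b2 ->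
  {ae P, forall w, b1 w = b2 w} -> P [set w | b1 w] = P [set w | b2 w].
Proof.
move=> mb1 mb2 b12; rewrite !probability_integral//.
apply: ae_eq_integral => //; try by apply/measurable_EFinP; solve_measurable.
by apply: filterS b12 => w -> _.
Qed.

(** * Independent pairs and densities *)

Section independent_variables.
Context d d1 d2 (T : measurableType d) (T1 : measurableType d1)
  (T2 : measurableType d2) (R : realType).
Variable P : probability T R.
Local Open Scope ereal_scope.

Definition independent_pair (X : T -> T1) (Y : T -> T2) : Prop :=
  forall E F, measurable E -> measurable F ->
  P (X @^-1` E `&` Y @^-1` F) = P (X @^-1` E) * P (Y @^-1` F).

(** The joint law of [X] and [Y] agrees with the product of their laws on
    rectangles, hence everywhere, and Tonelli applies. Both integrals are kept
    on the probability space, so that the variables can be peeled off one by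
    one without naming their laws. *)
Lemma integral_independent_pair (X : T -> T1) (Y : T -> T2)
    (f : T1 * T2 -> \bar R) :
  measurable_fun setT X -> measurable_fun setT Y -> independent_pair X Y ->
  measurable_fun setT f -> (forall z, 0 <= f z) ->
  \int[P]_w f (X w, Y w) = \int[P]_w \int[P]_v f (X w, Y v).
Proof.
move=> mX mY indXY mf f0.
pose X' : {mfun T >-> T1} := HB.pack X (isMeasurableFun.Build _ _ _ _ _ mX).
pose Y' : {mfun T >-> T2} := HB.pack Y (isMeasurableFun.Build _ _ _ _ _ mY).
have mXY : measurable_fun setT (fun w => (X w, Y w)).
  exact: measurable_fun_pair.
pose XY : {mfun T >-> (T1 * T2)%type} :=
  HB.pack (fun w => (X w, Y w)) (isMeasurableFun.Build _ _ _ _ _ mXY).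
transitivity (\int[distribution P XY]_z f z).
  by rewrite ge0_integral_distribution.
transitivity (\int[distribution P X' \x distribution P Y']_z f z).
  apply: eq_measure_integral => A mA _; apply/esym.
  exact: product_measure_unique.
rewrite fubini_tonelli1// ge0_integral_distribution//=; last 2 first.
- exact: measurable_fun_fubini_tonelli_F.
- by move=> x; exact: integral_ge0.
apply: eq_integral => w _.
rewrite /fubini_F ge0_integral_distribution//=.
exact/measurableT_comp.
Qed.

End independent_variables.

Lemma probability_independent_pair d d1 d2 (T : measurableType d)
    (T1 : measurableType d1) (T2 : measurableType d2) (R : realType)
    (P : probability T R) (X : T -> T1) (Y : T -> T2) (B : T1 * T2 -> bool) :
  measurable_fun setT X -> measurable_fun setT Y -> independent_pair P X Y ->
  measurable_fun setT B ->
  P [set w | B (X w, Y w)] = (\int[P]_w P [set v | B (X w, Y v)])%E.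
Proof.
move=> mX mY indXY mB.
have mXY : measurable_fun setT (fun w => B (X w, Y w)).
  by apply: (measurableT_comp mB); exact: measurable_fun_pair.
rewrite probability_integral//.
rewrite (integral_independent_pair (f := fun z => (B z)%:R%:E) mX mY indXY)//.
- apply: eq_integral => w _; rewrite probability_integral//.
  by apply: (measurableT_comp mB); exact: measurable_fun_pair.
- by apply/measurable_EFinP; solve_measurable.
Qed.

(** [f] is almost everywhere the Radon-Nikodym derivative of [nu]. *)
Lemma integral_density d (T : measurableType d) (R : realType)
    (mu : {sigma_finite_measure set T -> \bar R})
    (nu : {finite_measure set T -> \bar R}) (f : T -> R) (h : T -> \bar R) :
  measurable_fun setT f -> (forall x, 0 <= f x) ->
  (forall A, measurable A -> nu A = \int[mu]_(x in A) (f x)%:E)%E ->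
  measurable_fun setT h -> (forall x, 0 <= h x)%E ->
  (\int[nu]_x h x = \int[mu]_x (h x * (f x)%:E))%E.
Proof.
move=> mf f0 nuE mh h0.
have numu : nu `<< mu.
  apply/null_content_dominatesP => A mA muA0; rewrite nuE//.
  apply: null_set_integral => //.
  by apply/measurable_EFinP; exact: measurable_funTS.
rewrite -(Radon_Nikodym_SigmaFinite.change_of_variables numu)//.
apply: ae_eq_integral => //.
- apply: emeasurable_funM => //.
  exact: measurable_int (Radon_Nikodym_SigmaFinite.f_integrable _).
- by apply: emeasurable_funM => //; exact/measurable_EFinP.
apply: ae_eqe_mul2l => /=.
apply: integral_ae_eq => //=.
- exact: Radon_Nikodym_SigmaFinite.f_integrable.
- exact/measurable_EFinP.
- by move=> E _ mE; rewrite -nuE// -Radon_Nikodym_SigmaFinite.f_integral.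
Qed.

(** * Independence of one variable from the others *)

Section sigma_family_theory.
Context d (T : measurableType d) (R : realType) (I : choiceType).
Variables (P : probability T R) (X : I -> T -> R).

(** The sample space with [sigma_family D X] as its measurable sets: membership
    of an event in that sigma-algebra becomes measurability of functions, which
    composes. *)
Definition sigma_familyType (D : set I) : measurableType _ :=
  g_sigma_algebraType (\bigcup_(i in D) g_sigma_algebra_preimage (X i)).

Lemma measurable_sigma_family (D : set I) (i : I) : D i ->
  measurable_fun (setT : set (sigma_familyType D)) (X i).
Proof.
move=> Di _ B mB; rewrite setTI; apply: sub_sigma_algebra.
by exists i => //; exists B => //; rewrite setTI.
Qed.

Lemma sigma_family_preimage d' (T' : measurableType d') (D : set I)
    (f : T -> T') (E : set T') :
  measurable_fun (setT : set (sigma_familyType D)) f -> measurable E ->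
  sigma_family D X (f @^-1` E).
Proof. by move=> mf mE; rewrite -[_ @^-1` _]setTI; exact: mf. Qed.

(** For fixed [B], both sides are finite measures in [E]. They agree on the
    finite intersections of events [X j @^-1` C j] with [j] in [D1] by mutual
    independence, and these form a pi-system generating the sigma-algebra. *)
Lemma mutually_independent_rest (D D1 : set I) (i : I) :
  mutually_independent P D X -> (forall j, D j -> measurable_fun setT (X j)) ->
  D1 `<=` D -> D i -> ~ D1 i ->
  forall E B, sigma_family D1 X E -> measurable B ->
  P (E `&` X i @^-1` B) = (P E * P (X i @^-1` B))%E.
Proof.
move=> indX mX D1D Di D1i E B sE mB.
pose G := [set A : set T | exists (J : {fset I}) (C : I -> set R),
  [/\ [set` J] `<=` D1, forall j, measurable (C j) &
      A = \bigcap_(j in [set` J]) (X j @^-1` C j)]].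
have mpre j C : D j -> measurable C -> measurable (X j @^-1` C).
  by move=> Dj mC; rewrite -[_ @^-1` _]setTI; exact: mX.
have Gm : G `<=` measurable.
  move=> _ [J [C [JD mC ->]]]; apply: fin_bigcap_measurable => // j Jj.
  by apply: mpre => //; exact/D1D/JD.
have GT : G setT.
  exists fset0, (fun=> setT); split=> //.
  by apply/seteqP; split=> // w _ j /=; rewrite inE.
have GI : setI_closed G.
  move=> _ _ [J [C [JD mC ->]]] [J' [C' [J'D mC' ->]]].
  (* Padding with setT lets both families of constraints be indexed by the
     union of the two index sets. *)
  pose ext (K : {fset I}) (F : I -> set R) j := if j \in K then F j else setT.
  have mext K F : (forall j, measurable (F j)) ->
      forall j, measurable (ext K F j).
    by move=> mF j; rewrite /ext; case: ifP.
  exists (J `|` J')%fset, (fun j => ext J C j `&` ext J' C' j); split.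
  - by move=> j /=; rewrite inE => /orP[/JD|/J'D].
  - by move=> j; apply: measurableI; exact: mext.
  - apply/seteqP; split=> [w [wC wC'] j /= _|w wI].
      by split; rewrite /ext; case: ifPn => // jJ; [exact: wC|exact: wC'].
    split=> j /= jJ.
      have /= := wI j; rewrite inE jJ => /(_ isT)[].
      by rewrite /ext jJ.
    have /= := wI j; rewrite inE jJ orbT => /(_ isT)[_].
    by rewrite /ext jJ.
have mXB := mpre _ _ Di mB.
have PXB : 0 <= fine (P (X i @^-1` B)) by exact: fine_ge0.
have <- : mrestr P mXB E = P (E `&` X i @^-1` B) by [].
rewrite muleC -[X in (X * _)%E]fineK ?fin_num_measure//.
rewrite -[RHS]/(mscale (NngNum PXB) P E).
apply: (g_sigma_algebra_measure_unique G Gm (fun=> setT)) => //.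
- by rewrite bigcup_const.
- move=> _ [J [C [JD mC ->]]].
  change (P (\bigcap_(j in [set` J]) (X j @^-1` C j) `&` X i @^-1` B) =
    (fine (P (X i @^-1` B)))%:E *
    P (\bigcap_(j in [set` J]) (X j @^-1` C j)))%E.
  rewrite fineK ?fin_num_measure// [RHS]muleC.
  have iJ : i \notin J by apply/negP => /JD.
  pose C' j := if j == i then B else C j.
  have C'i : C' i = B by rewrite /C' eqxx.
  have C'J j : j \in J -> C' j = C j.
    by rewrite /C'; case: eqP => // ->; rewrite (negPf iJ).
  have -> : \bigcap_(j in [set` J]) (X j @^-1` C j) `&` X i @^-1` B =
      \bigcap_(j in [set` (i |` J)%fset]) (X j @^-1` C' j).
    apply/seteqP; split=> [w [wC wB] j /=|w wC].
      rewrite in_fset1U => /orP[/eqP ->|jJ]; first by rewrite C'i.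
      by rewrite C'J//; exact: wC.
    split=> [j jJ|].
      by rewrite -C'J//; apply: wC; rewrite /= in_fset1U jJ orbT.
    by have := wC i; rewrite /= in_fset1U eqxx C'i; exact.
  rewrite indX; first last.
  + by move=> j _; rewrite /C'; case: ifP.
  + by move=> j /=; rewrite in_fset1U => /orP[/eqP ->|/JD/D1D].
  rewrite big_fsetU1//= C'i muleC; congr (_ * _)%E.
  rewrite indX//; last exact: subset_trans JD D1D.
  by apply: eq_big_seq => j jJ; rewrite /= C'J.
- by move=> k; rewrite -ge0_fin_numE ?fin_num_measure.
- apply: sub_sigma_algebra2 E sE => _ [j D1j [C mC <-]].
  exists [fset j]%fset, (fun=> C); split=> //.
    by move=> k /=; rewrite inE => /eqP ->.
  rewrite setTI; apply/seteqP; split=> [w wC k /=|w].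
    by rewrite inE => /eqP ->.
  by apply; rewrite /= inE.
Qed.

End sigma_family_theory.

(** * Integrals of exponentials over half-lines *)

Section exponential_integrals.
Context {R : realType}.
Implicit Types p q s t x theta : R.

Lemma cvg_expRNM theta : 0 < theta ->
  expR (- theta * x) @[x --> +oo] --> (0 : R).
Proof.
move=> theta0.
rewrite (_ : (fun x => expR (- theta * x)) =
             (fun z => expR (- z)) \o (fun z => theta * z)); last first.
  by apply: eq_fun => x; rewrite mulNr.
apply: (@cvg_comp _ _ _ _ _ _ (pinfty_nbhs R)); last exact: cvgr_expR.
exact: gt0_cvgMry.
Qed.

Lemma cvg_MexpRNM theta : 0 < theta ->
  x * expR (- theta * x) @[x --> +oo] --> (0 : R).
Proof.
move=> theta0.
have th2 : 0 < theta / 2 by rewrite divr_gt0.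
(* One half of the exponent absorbs the factor x, since 1 + u <= expR u at
   u = theta / 2 * x; the other half still decays. *)
have h : 2 / theta * expR (- (theta / 2) * x) @[x --> +oo] --> (0 : R).
  rewrite -[X in _ --> X](mulr0 (2 / theta)).
  by apply: cvgM; [exact: cvg_cst|exact: cvg_expRNM].
apply: squeeze_cvgr (cvg_cst 0) h.
near=> x.
have x0 : 0 <= x by near: x; exact: nbhs_pinfty_ge.
apply/andP; split; first by rewrite mulr_ge0 ?expR_ge0.
have -> : - theta * x = - (theta / 2) * x + - (theta / 2) * x by field.
rewrite expRD mulrA ler_wpM2r ?expR_ge0//.
rewrite mulNr expRN ler_pdivrMr ?expR_gt0//.
rewrite -ler_pdivrMl ?divr_gt0// invf_div.
apply: le_trans (expR_ge1Dx _).
by rewrite ler_wpDl.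
Unshelve. all: by end_near. Qed.

Lemma is_derive_affine (a b x : R) : is_derive x 1 (fun y => a * y + b) a.
Proof.
have -> : (fun y => a * y + b) = (a \*: (id : R -> R^o)) + cst b by [].
apply: is_derive_eq.
by rewrite addr0 /GRing.scale/= mulr1.
Qed.

Lemma is_derive_expRM (a x : R) :
  is_derive x 1 (fun y => expR (a * y)) (a * expR (a * x)).
Proof.
have -> : (fun y => expR (a * y)) = expR \o (fun y => a * y + 0).
  by apply/funext => y /=; rewrite addr0.
apply: is_derive_eq.
by rewrite !addr0 /GRing.scale/= mulr1 mulrC.
Qed.

(** The half-line integrals that occur are evaluated through this one, whose
    antiderivative is explicit and vanishes at infinity. *)
Lemma integral_affine_expR p q s theta :
  0 <= p -> 0 <= q -> 0 < theta ->
  (\int[lebesgue_measure]_(x in `[s, +oo[)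
      ((p * (x - s) + q) * expR (- theta * x))%:E =
   (expR (- theta * s) * (p / theta ^+ 2 + q / theta))%:E)%E.
Proof.
move=> p0 q0 theta0; have thetaN0 : theta != 0 by rewrite gt_eqF.
pose F x := - ((p * (x - s) + (p / theta + q)) / theta * expR (- theta * x)).
have dF x : is_derive x 1 F ((p * (x - s) + q) * expR (- theta * x)).
  pose a y := - (p / theta) * y + - ((p / theta + q - p * s) / theta).
  pose e y := expR (- theta * y).
  have -> : F = a * e :> (R -> R).
    apply/funext => y; change (F y = a y * e y).
    by rewrite /F /a /e; field.
  have h := is_deriveM (is_derive_affine _ _ x : is_derive x 1 a _)
    (is_derive_expRM _ x : is_derive x 1 e _).
  apply: (is_derive_eq h); rewrite /a /e.
  by rewrite /GRing.scale/=; field.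
have cF : continuous F.
  by move=> x; apply: differentiable_continuous; apply/derivable1_diffP.
rewrite (@ge0_continuous_FTC2y _ _ F s 0).
- by congr EFin; rewrite /F; field.
- by move=> x sx; rewrite mulr_ge0 ?expR_ge0// addr_ge0// mulr_ge0// subr_ge0.
- apply: continuous_subspaceT => x.
  apply: cvgM.
    apply: cvgD; last exact: cvg_cst.
    apply: cvgM; first exact: cvg_cst.
    by apply: cvgB; [exact: cvg_id|exact: cvg_cst].
  apply: continuous_comp; last exact: continuous_expR.
  by apply: cvgM; [exact: cvg_cst|exact: cvg_id].
- rewrite (_ : F = fun x => - (p / theta) * (x * expR (- theta * x)) +
      - ((p / theta + q - p * s) / theta) * expR (- theta * x)); last first.
    by apply/funext => x; rewrite /F; field.
  rewrite -[X in _ --> X]addr0 -[X in _ --> X + _](mulr0 (- (p / theta))).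
  rewrite -[X in _ --> _ + X](mulr0 (- ((p / theta + q - p * s) / theta))).
  apply: cvgD; apply: cvgM; try exact: cvg_cst.
    exact: cvg_MexpRNM.
  exact: cvg_expRNM.
- move=> x _; exact: ex_derive.
- exact/cvg_at_right_filter/cF.
- by move=> x _; rewrite derive1E; exact: derive_val.
Qed.

Lemma integral_expR s theta : 0 < theta ->
  (\int[lebesgue_measure]_(x in `[s, +oo[) (theta * expR (- theta * x))%:E =
   (expR (- theta * s))%:E)%E.
Proof.
move=> theta0.
have := @integral_affine_expR 0 theta s theta (lexx 0) (ltW theta0) theta0.
rewrite mul0r add0r divff ?gt_eqF// mulr1 => <-.
by apply: eq_integral => x _; rewrite mul0r add0r.
Qed.

(** Up to [t] the two exponentials multiply to the constant
    [expR (- theta * t)], which contributes the term in [t - s]; beyond [t] the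
    integrand decays at rate [2 * theta], which contributes the [2^-1]. *)
Lemma integral_expR_dist s t theta : 0 < theta -> s <= t ->
  (\int[lebesgue_measure]_(x in `[s, +oo[)
      (expR (- theta * `|t - x|) * (theta * expR (- theta * x)))%:E =
   ((theta * (t - s) + 2^-1) * expR (- theta * t))%:E)%E.
Proof.
move=> theta0 st.
have mf D : measurable_fun D
    (fun x => (expR (- theta * `|t - x|) * (theta * expR (- theta * x)))%:E).
  apply/measurable_EFinP; apply: measurable_funM.
    apply: measurableT_comp => //; apply: measurable_funM => //.
    by apply: measurableT_comp => //; exact: measurable_funB.
  apply: measurable_funM => //.
  by apply: measurableT_comp => //; exact: measurable_funM.
rewrite (@itv_bndbnd_setU _ _ (BLeft s) (BLeft t) +oo%O)// ?bnd_simp//.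
rewrite ge0_integral_setU//=; last 3 first.
- exact: mf.
- by move=> x _; rewrite lee_fin !mulr_ge0 ?expR_ge0// ltW.
- apply: lt_disjoint => x y; rewrite !in_itv/= andbT => /andP[_ /lt_le_trans].
  exact.
rewrite (eq_integral (fun=> (theta * expR (- theta * t))%:E)); last first.
  move=> x; rewrite inE/= in_itv/= => /andP[_ xt]; congr EFin.
  rewrite mulrCA -expRD ger0_norm ?subr_ge0 ?(ltW xt)//; congr (_ * expR _).
  by ring.
rewrite integral_cst//= lebesgue_measure_itv/= lte_fin.
rewrite (_ : (if s < t then _ else _) = (t - s)%:E); last first.
  by case: ltgtP st => // -> _; rewrite subrr.
have theta20 : 0 < 2 * theta by rewrite mulr_gt0.
(* On the tail the integrand is cast as an affine one with zero slope. *)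
rewrite [X in (_ + X)%E](_ : _ = \int[lebesgue_measure]_(x in `[t, +oo[)
    ((0 * (x - t) + theta * expR (theta * t)) *
    expR (- (2 * theta) * x))%:E)%E; last first.
  apply: eq_integral => x; rewrite inE/= in_itv/= andbT => tx; congr EFin.
  rewrite mul0r add0r mulrCA -mulrA -!expRD ler0_norm ?subr_le0//.
  by congr (_ * expR _); ring.
rewrite integral_affine_expR// ?mulr_ge0 ?expR_ge0 ?ltW//.
rewrite -EFinM -EFinD; congr EFin; rewrite mul0r add0r.
have -> : - (2 * theta) * t = - theta * t + - (theta * t) by ring.
rewrite expRD expRN; field.
by rewrite gt_eqF//= gt_eqF ?expR_gt0.
Qed.

End exponential_integrals.

(** * Expectations of functions of an exponential variable *)

Section exponential_law_theory.
Context d (T : measurableType d) (R : realType).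
Variables (P : probability T R) (rate : R) (Y : T -> R).
Hypotheses (rate_gt0 : 0 < rate) (mY : measurable_fun setT Y)
  (expY : exponential_law P rate Y).

Lemma integral_exponential_law (h : R -> R) :
  measurable_fun setT h -> (forall y, 0 <= h y) ->
  (\int[P]_w (h (Y w))%:E =
   \int[lebesgue_measure]_(y in `[0%R, +oo[)
     (h y * (rate * expR (- rate * y)))%:E)%E.
Proof.
move=> mh h0.
(* The law is taken on [measurableTypeR R], the structure that carries the
   Lebesgue measure. *)
have mY' : measurable_fun setT (Y : T -> measurableTypeR R) by exact: mY.
pose Y' : {mfun T >-> measurableTypeR R} :=
  HB.pack (Y : T -> measurableTypeR R) (isMeasurableFun.Build _ _ _ _ _ mY').
have mEh : measurable_fun setT (EFin \o h) by exact/measurable_EFinP.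
transitivity (\int[distribution P Y']_y (h y)%:E)%E.
  by rewrite ge0_integral_distribution.
rewrite (@integral_density _ _ _ lebesgue_measure (distribution P Y')
  (exponential_pdf rate) (EFin \o h))//.
- rewrite [RHS]integral_mkcond; apply: eq_integral => y _.
  rewrite -EFinM /exponential_pdf !patchE; case: ifPn => // _.
  by rewrite mulr0.
- exact: measurable_exponential_pdf.
- by move=> y; apply: exponential_pdf_ge0; exact: ltW.
Qed.

Lemma integral_exponential_law_above (s : R) (h : R -> R) : 0 <= s ->
  measurable_fun setT h -> (forall y, 0 <= h y) ->
  (\int[P]_w ((s < Y w)%R%:R * h (Y w))%:E =
   \int[lebesgue_measure]_(y in `[s, +oo[)
     (h y * (rate * expR (- rate * y)))%:E)%E.
Proof.
move=> s0 mh h0.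
have md : measurable_fun setT (fun y => (h y * (rate * expR (- rate * y)))%:E).
  by apply/measurable_EFinP; solve_measurable.
rewrite (@integral_exponential_law (fun y => (s < y)%R%:R * h y)); last 2 first.
- by solve_measurable.
- by move=> y; rewrite mulr_ge0.
rewrite -[RHS]integral_itv_obnd_cbnd; last exact: measurable_funTS.
rewrite [LHS]integral_mkcond [RHS]integral_mkcond; apply: eq_integral => y _.
rewrite !patchE !mem_setE !in_itv/= !andbT.
have [sy|ys] := ltP s y; last by rewrite !mul0r; case: ifP.
by rewrite (ltW (le_lt_trans s0 sy)) mul1r.
Qed.

Lemma exponential_law_gt0 : {ae P, forall w, 0 < Y w}.
Proof.
have mE : measurable [set w | 0 < Y w].
  rewrite -[X in measurable X]setTI.
  have := measurable_fun_ltr (measurable_cst (0 : R)) mY.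
  by move=> /(_ measurableT [set true]); exact.
have PE : P [set w | 0 < Y w] = 1%E.
  have := @integral_exponential_law_above 0 (cst 1) (lexx 0)
    (measurable_cst (1 : R)) (fun=> ler01).
  under [X in _ = X -> _]eq_integral => y _ do rewrite mul1r.
  rewrite integral_expR// mulr0 expR0 => <-.
  rewrite -[X in P X]setIT -integral_indic//; apply: eq_integral => w _.
  by rewrite indicE mem_setE mulr1.
exists (~` [set w | 0 < Y w]); split => //.
- exact: measurableC.
- by rewrite probability_setC// PE subee.
Qed.

End exponential_law_theory.

Section independent_exponential.
Context d d1 (T : measurableType d) (T1 : measurableType d1) (R : realType).
Variables (P : probability T R) (rate : R) (X : T -> T1) (Y : T -> R).
Hypotheses (rate_gt0 : 0 < rate) (mX : measurable_fun setT X)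
  (mY : measurable_fun setT Y) (expY : exponential_law P rate Y)
  (indXY : independent_pair P X Y).

(** The threshold [s] may depend on [X]: this is what removes a service time
    from an event in which it must exceed a function of earlier ones. *)
Lemma integral_independent_exponential (s : T1 -> R) (f : T1 -> R -> R) :
  measurable_fun setT s -> measurable_fun setT (fun z => f z.1 z.2) ->
  (forall x, 0 <= s x) -> (forall x y, 0 <= f x y) ->
  (\int[P]_w ((s (X w) < Y w)%R%:R * f (X w) (Y w))%:E =
   \int[P]_w \int[lebesgue_measure]_(y in `[s (X w), +oo[)
     (f (X w) y * (rate * expR (- rate * y)))%:E)%E.
Proof.
move=> ms mf s0 f0.
pose g z := ((s z.1 < z.2)%R%:R * f z.1 z.2)%:E.
have mg : measurable_fun setT g.
  apply/measurable_EFinP; apply: measurable_funM => //.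
  apply: (measurable_fun_natr measurableT); apply: measurable_fun_ltr => //.
  exact: measurableT_comp.
have g0 z : (0 <= g z)%E by rewrite lee_fin mulr_ge0.
rewrite (integral_independent_pair mX mY indXY mg g0).
apply: eq_integral => w _.
have mfw : measurable_fun setT (f (X w)).
  exact: (measurableT_comp mf (pair1_measurable _)).
by rewrite -(integral_exponential_law_above rate_gt0 mY expY (s0 _) mfw).
Qed.

Lemma integral_independent_exponential_tail (s h : T1 -> R) :
  measurable_fun setT s -> measurable_fun setT h ->
  (forall x, 0 <= s x) -> (forall x, 0 <= h x) ->
  (\int[P]_w ((s (X w) < Y w)%R%:R * h (X w))%:E =
   \int[P]_w (h (X w) * expR (- rate * s (X w)))%:E)%E.
Proof.
move=> ms mh s0 h0.
rewrite (@integral_independent_exponential s (fun x _ => h x))//; last first.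
  exact: measurableT_comp.
apply: eq_integral => w _; under eq_integral => y _ do rewrite EFinM.
rewrite ge0_integralZl_EFin//.
- by rewrite integral_expR// -EFinM.
- by move=> y _; rewrite lee_fin mulr_ge0 ?expR_ge0// ltW.
- apply/measurable_EFinP; apply: measurable_funM => //.
  by apply: measurableT_comp => //; exact: measurable_funM.
Qed.

End independent_exponential.

(** * Overlaps for a fixed time between the two arrivals *)

Section four_services.
Context d (T : measurableType d) (R : realType).
Variables (P : probability T R) (mu : R) (a b c e : T -> R).
Hypotheses (mu_gt0 : 0 < mu)
  (ma : measurable_fun setT a) (mb : measurable_fun setT b)
  (mc : measurable_fun setT c) (me : measurable_fun setT e)
  (expa : exponential_law P mu a) (expb : exponential_law P mu b)
  (expc : exponential_law P mu c) (expe : exponential_law P mu e)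
  (ind_ca : independent_pair P c a)
  (ind_cab : independent_pair P (fun w => (c w, a w)) b)
  (ind_cabe : independent_pair P (fun w => (c w, a w, b w)) e).

Lemma probability_both_exceed (s r : R) : 0 <= s -> 0 <= r ->
  P [set w | (s < a w) && (r < c w)] = (expR (- mu * s) * expR (- mu * r))%:E.
Proof.
move=> s0 r0; rewrite probability_integral; last first.
  by apply: measurable_and; solve_measurable.
transitivity (\int[P]_w ((s < a w)%R%:R * (r < c w)%R%:R)%:E)%E.
  by apply: eq_integral => w _; rewrite -natrM mulnb.
rewrite (@integral_independent_exponential_tail _ _ _ _ _ P mu c a mu_gt0 mc
  ma expa ind_ca (fun=> s) (fun x => (r < x)%R%:R))//; last by solve_measurable.
rewrite (@integral_exponential_law_above _ _ _ P mu c mu_gt0 mc expc r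
  (fun=> expR (- mu * s)))//.
under eq_integral => x _ do rewrite EFinM.
rewrite ge0_integralZl_EFin ?expR_ge0//; last 2 first.
- by move=> x _; rewrite lee_fin mulr_ge0 ?expR_ge0// ltW.
- by apply/measurable_EFinP; apply: measurable_funTS; solve_measurable.
by rewrite integral_expR.
Qed.

(* The thresholds that [b] and [e] must exceed, as functions of [(c, a)]. *)
Let m1 (g y : R) (z : R * R) := y + Num.max (g + z.1 - z.2) 0.
Let m2 (g y : R) (z : R * R) := y + Num.max (z.2 - g - z.1) 0.

Let maxD (u : R) : Num.max u 0 + Num.max (- u) 0 = `|u|.
Proof.
case/orP: (le_total u 0) => u0.
  by rewrite max_r// add0r max_l ?oppr_ge0// ler0_norm.
by rewrite max_l// max_r ?oppr_le0// addr0 ger0_norm.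
Qed.

(** The variables are integrated out in the order [e], [b], [a], [c]: the first
    two leave [expR (- 2 * mu * y) * expR (- mu * `|g + c - a|)], and the other
    two are [integral_expR_dist] and [integral_affine_expR]. The lower bounds
    [s] on [a] and [r] on [c] make the lemma serve for the second overlap alone
    and for both overlaps at once. *)
Lemma probability_second_overlap (g s r y : R) :
  0 <= g -> 0 <= s -> 0 <= r -> 0 <= y -> s <= g + r ->
  P [set w | [&& s < a w, r < c w,
                 y + Num.max (g + c w - a w) 0 < b w
               & y + Num.max (a w - g - c w) 0 < e w]] =
  (expR (- 2 * mu * y) * expR (- mu * g) * expR (- 2 * mu * r)
   * ((1 + mu * (g + r - s)) / 2))%:E.
Proof.
move=> g0 s0 r0 y0 sgr; rewrite probability_integral; last first.
  by do 3 (apply: measurable_and; first solve_measurable); solve_measurable.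
have m10 z : 0 <= m1 g y z by rewrite addr_ge0// le_max lexx orbT.
have m20 z : 0 <= m2 g y z by rewrite addr_ge0// le_max lexx orbT.
pose h2 (z : R * R * R) : R := (m1 g y z.1 < z.2)%R%:R *
  ((s < z.1.2)%R%:R * (r < z.1.1)%R%:R).
transitivity
  (\int[P]_w ((m2 g y (c w, a w) < e w)%R%:R * h2 (c w, a w, b w))%:E)%E.
  apply: eq_integral => w _; rewrite /h2 /m1 /m2/= -!natrM !mulnb.
  by case: (s < a w); case: (r < c w); case: (_ < b w); case: (_ < e w).
rewrite (@integral_independent_exponential_tail _ _ _ _ _ P mu
  (fun w => (c w, a w, b w)) e mu_gt0 _ me expe ind_cabe
  (fun z => m2 g y z.1) h2)//; last 4 first.
- by solve_measurable.
- by rewrite /m2; solve_measurable.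
- by rewrite /h2 /m1; solve_measurable.
- by move=> z; rewrite !mulr_ge0.
pose h1 (z : R * R) : R :=
  (s < z.2)%R%:R * (r < z.1)%R%:R * expR (- mu * m2 g y z).
transitivity (\int[P]_w ((m1 g y (c w, a w) < b w)%R%:R * h1 (c w, a w))%:E)%E.
  by apply: eq_integral => w _; rewrite /h2 /h1/= !mulrA.
rewrite (@integral_independent_exponential_tail _ _ _ _ _ P mu
  (fun w => (c w, a w)) b mu_gt0 _ mb expb ind_cab (m1 g y) h1)//;
  last 4 first.
- by solve_measurable.
- by rewrite /m1; solve_measurable.
- by rewrite /h1 /m2; solve_measurable.
- by move=> z; rewrite !mulr_ge0 ?expR_ge0.
pose K := expR (- 2 * mu * y).
pose f x t := (r < x)%R%:R * K * expR (- mu * `|g + x - t|).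
transitivity (\int[P]_w ((s < a w)%R%:R * f (c w) (a w))%:E)%E.
  apply: eq_integral => w _.
  rewrite /h1 /f/= -!mulrA -expRD; congr (_ * (_ * _))%:E.
  rewrite /K -expRD /m1 /m2 /= -maxD; congr expR.
  rewrite (_ : a w - g - c w = - (g + c w - a w)); first by ring.
  by ring.
rewrite (@integral_independent_exponential _ _ _ _ _ P mu c a mu_gt0 mc
  ma expa ind_ca (fun=> s) f)//; last 2 first.
- by rewrite /f; solve_measurable.
- by move=> x t; rewrite /f !mulr_ge0 ?expR_ge0.
(* The positive part keeps [h] nonnegative everywhere; for r < x it is just
   g + x - s, because s <= g + r. *)
pose h x := K * ((mu * Num.max (g + x - s) 0 + 2^-1) * expR (- mu * (g + x))).
transitivity (\int[P]_w ((r < c w)%R%:R * h (c w))%:E)%E.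
  apply: eq_integral => w _; rewrite /f /h.
  under eq_integral => x _ do rewrite -mulrA EFinM.
  rewrite ge0_integralZl_EFin ?mulr_ge0 ?expR_ge0//; last 2 first.
  - by move=> x _; rewrite lee_fin !mulr_ge0 ?expR_ge0// ltW.
  - by apply/measurable_EFinP; apply: measurable_funTS; solve_measurable.
  have [rc|] := ltP r (c w); last by rewrite !mul0r mul0e.
  have scg : s <= g + c w by rewrite (le_trans sgr)// lerD2l ltW.
  by rewrite integral_expR_dist// -EFinM !mul1r max_l ?subr_ge0.
rewrite (@integral_exponential_law_above _ _ _ P mu c mu_gt0 mc expc r h)//;
  last 2 first.
- by rewrite /h; solve_measurable.
- move=> x; rewrite /h !mulr_ge0 ?expR_ge0// addr_ge0// mulr_ge0 ?(ltW mu_gt0)//.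
  by rewrite le_max lexx orbT.
pose L := K * expR (- mu * g) * mu.
transitivity (\int[lebesgue_measure]_(x in `[r, +oo[)
  (((L * mu) * (x - r) + L * (mu * (g + r - s) + 2^-1)) *
    expR (- (2 * mu) * x))%:E)%E.
  apply: eq_integral => x; rewrite inE/= in_itv/= andbT => rx; congr EFin.
  rewrite /h max_l; last by rewrite subr_ge0 (le_trans sgr)// lerD2l.
  rewrite (_ : - (2 * mu) * x = - mu * x + - mu * x); last by ring.
  by rewrite (mulrDr (- mu) g x) !expRD /L; field.
have p0 : 0 <= L * mu by rewrite !mulr_ge0 ?expR_ge0 ?(ltW mu_gt0).
have q0 : 0 <= L * (mu * (g + r - s) + 2^-1).
  by rewrite mulr_ge0 ?addr_ge0 ?mulr_ge0 ?expR_ge0 ?(ltW mu_gt0) ?subr_ge0.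
have t0 : 0 < 2 * mu by rewrite mulr_gt0.
rewrite (integral_affine_expR r p0 q0 t0).
congr EFin; rewrite /L /K mulNr -mulNr.
rewrite (_ : - 2 * mu * r = - (2 * mu) * r); last by ring.
by field; rewrite gt_eqF.
Qed.

End four_services.

(** * The time between two arrivals *)

Section gap.
Context d (T : measurableType d) (R : realType).
Variables (P : probability T R) (rate mu : R) (D : set nat) (X : nat -> T -> R).
Hypotheses (rate_gt0 : 0 < rate) (mu_gt0 : 0 < mu)
  (mX : forall i, D i -> measurable_fun setT (X i))
  (iidX : iid_exponential P rate D X).
Variables (m : nat) (Dm : forall i, (m <= i)%N -> D i).

Let G k w := \sum_(m <= i < m + k) X i w.

Let GS k w : G k.+1 w = G k w + X (m + k)%N w.
Proof. by rewrite /G addnS big_nat_recr//= leq_addr. Qed.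

Lemma measurable_gap k : measurable_fun setT (G k).
Proof.
elim: k => [|k IH].
  rewrite (_ : G 0 = cst 0) //; apply/funext => w.
  by rewrite /G addn0 big_geq.
rewrite (_ : G k.+1 = fun w => G k w + X (m + k)%N w); last exact/funext/GS.
by apply: measurable_funD => //; apply: mX; apply: Dm; exact: leq_addr.
Qed.

Lemma gap_ge0 k : {ae P, forall w, 0 <= G k w}.
Proof.
elim: k => [|k IH].
  by apply: nearW => w; rewrite /G addn0 big_geq.
have Dk := Dm (leq_addr k m).
have := exponential_law_gt0 rate_gt0 (mX Dk) (iidX.2 _ Dk).
by apply: filterS2 IH => w Gw Xw; rewrite GS addr_ge0// ltW.
Qed.

Lemma independent_gap k : independent_pair P (G k) (X (m + k)%N).
Proof.
have [indX _] := iidX.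
move=> E F mE mF.
pose D1 := [set i | (m <= i < m + k)%N].
apply: (mutually_independent_rest (D1 := D1) indX mX) => //.
- by move=> i /= /andP[mi _]; exact: Dm.
- by apply: Dm; exact: leq_addr.
- by rewrite /D1/= ltnn andbF.
apply: sigma_family_preimage => //.
have mG j : (j <= k)%N ->
    measurable_fun (setT : set (sigma_familyType X D1)) (G j).
  elim: j => [_|j IH jk].
    rewrite (_ : G 0 = cst 0); first exact: measurable_cst.
    by apply/funext => w; rewrite /G addn0 big_geq.
  rewrite (_ : G j.+1 = fun w => G j w + X (m + j)%N w); last exact/funext/GS.
  apply: measurable_funD; first by apply: IH; exact: ltnW.
  by apply: measurable_sigma_family; rewrite /D1/= leq_addr ltn_add2l.
exact: mG.
Qed.

(** The positive part makes the integrand nonnegative on the whole sample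
    space; it is almost surely inactive. Generality in [p] and [q] is what the
    induction needs, since removing one summand changes both. *)
Lemma expectation_gap k p q : 0 <= p -> 0 <= q ->
  (\int[P]_w ((p * Num.max (G k w) 0 + q) * expR (- mu * G k w))%:E =
   ((rate / (rate + mu)) ^+ k * (q + k%:R * p / (rate + mu)))%:E)%E.
Proof.
have rm0 : 0 < rate + mu by rewrite addr_gt0.
elim: k p q => [|k IH] p q p0 q0.
  rewrite (eq_integral (fun=> q%:E)); last first.
    by move=> w _; rewrite /G addn0 big_geq// maxxx !mulr0 expR0 add0r mulr1.
  rewrite integral_cst// [X in (_ * X)%E](probability_setT P).
  by rewrite mule1 expr0 !mul0r addr0 mul1r.
have max0 (u : R) : 0 <= Num.max u 0 by rewrite le_max lexx orbT.
have mG := measurable_gap k.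
have Dk := Dm (leq_addr k m).
have mXk := mX Dk.
pose phi p q g := (p * Num.max g 0 + q) * expR (- mu * g).
have phi0 p' q' g : 0 <= p' -> 0 <= q' -> 0 <= phi p' q' g.
  by move=> ? ?; rewrite mulr_ge0 ?expR_ge0// addr_ge0// mulr_ge0.
(* The indicator discards the null event G k < 0, on which the closed form of
   the inner integral fails. *)
pose f x y := (0 <= x)%R%:R * phi p q (x + y).
transitivity (\int[P]_w ((0 < X (m + k)%N w)%R%:R *
    f (G k w) (X (m + k)%N w))%:E)%E.
  rewrite integral_ae_true//; first last.
  - exact: (exponential_law_gt0 rate_gt0 mXk (iidX.2 _ Dk)).
  - by move=> w; rewrite mulr_ge0 ?phi0.
  - rewrite /f /phi; solve_measurable; exact: measurable_fun_ler.
  - exact: measurable_fun_ltr.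
  rewrite /f integral_ae_true//; first last.
  - exact: gap_ge0.
  - by move=> w; rewrite phi0.
  - by rewrite /phi; solve_measurable.
  - exact: measurable_fun_ler.
  by apply: eq_integral => w _; rewrite GS.
rewrite (@integral_independent_exponential _ _ _ _ _ P rate (G k)
  (X (m + k)%N) rate_gt0 mG mXk (iidX.2 _ Dk) (@independent_gap k)
  (fun=> 0) f)//; last 2 first.
- rewrite /f /phi; solve_measurable; exact: measurable_fun_ler.
- by move=> x y; rewrite /f mulr_ge0 ?phi0.
set al := rate / (rate + mu) in IH *.
have al0 : 0 <= al by rewrite divr_ge0 ?ltW.
pose q1 := q + p / (rate + mu).
have q10 : 0 <= q1 by rewrite addr_ge0// divr_ge0// ltW.
transitivity
  (\int[P]_w ((0 <= G k w)%R%:R * phi (al * p) (al * q1) (G k w))%:E)%E.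
  apply: eq_integral => w _.
  have [g0|g0] := leP 0 (G k w); last first.
    rewrite mul0r integral0_eq// => y _.
    by rewrite /f leNgt g0/= !mul0r.
  set g := G k w in g0 *.
  pose L := expR (- mu * g) * rate.
  transitivity (\int[lebesgue_measure]_(y in `[0%R, +oo[)
    (((L * p) * (y - 0) + L * (p * g + q)) *
      expR (- (rate + mu) * y))%:E)%E.
    apply: eq_integral => y; rewrite inE/= in_itv/= andbT => y0; congr EFin.
    rewrite /f g0 /phi max_l ?addr_ge0// mul1r.
    rewrite (_ : - (rate + mu) * y = - mu * y + - rate * y); last by ring.
    by rewrite (mulrDr (- mu) g y) !expRD /L; ring.
  have Lp0 : 0 <= L * p by rewrite !mulr_ge0 ?expR_ge0// ltW.
  have Lq0 : 0 <= L * (p * g + q).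
    by rewrite !mulr_ge0 ?addr_ge0 ?mulr_ge0 ?expR_ge0// ltW.
  rewrite (integral_affine_expR 0 Lp0 Lq0 rm0) mulr0 expR0.
  congr EFin; rewrite /phi /q1 /L /al max_l// [RHS]mul1r.
  by field; rewrite gt_eqF.
rewrite integral_ae_true//; first last.
- exact: gap_ge0.
- by move=> w; apply: phi0; exact: mulr_ge0.
- by rewrite /phi; solve_measurable.
- exact: measurable_fun_ler.
rewrite /phi IH; [|exact: mulr_ge0|exact: mulr_ge0].
congr EFin.
rewrite /q1 exprS -natr1; field.
by rewrite gt_eqF.
Qed.

End gap.

Section gap_mixture.
Context d d2 (T : measurableType d) (T2 : measurableType d2) (R : realType).
Variables (P : probability T R) (rate mu : R) (D : set nat) (X : nat -> T -> R).
Hypotheses (rate_gt0 : 0 < rate) (mu_gt0 : 0 < mu)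
  (mX : forall i, D i -> measurable_fun setT (X i))
  (iidX : iid_exponential P rate D X).
Variables (m : nat) (Dm : forall i, (m <= i)%N -> D i) (k : nat).
Variable V : T -> T2.
Hypothesis mV : measurable_fun setT V.

Let G w := \sum_(m <= i < m + k) X i w.

Hypothesis indGV : independent_pair P G V.

(** Conditioning on the gap: it suffices to know the probability of [B] for
    each fixed nonnegative value of the gap. *)
Lemma probability_gap_mixture (B : R * T2 -> bool) (p q : R) :
  measurable_fun setT B -> 0 <= p -> 0 <= q ->
  (forall g, 0 <= g ->
    P [set v | B (g, V v)] = ((p * g + q) * expR (- mu * g))%:E) ->
  P [set w | B (G w, V w)] =
    ((rate / (rate + mu)) ^+ k * (q + k%:R * p / (rate + mu)))%:E.
Proof.
move=> mB p0 q0 PB.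
have mG : measurable_fun setT G by exact: (measurable_gap mX Dm).
have G0 : {ae P, forall w, 0 <= G w} by exact: (gap_ge0 rate_gt0 mX iidX Dm).
have mBG : measurable_fun setT (fun w => B (G w, V w)).
  by apply: (measurableT_comp mB); exact: measurable_fun_pair.
have mposG : measurable_fun setT (fun w => 0 <= G w).
  exact: measurable_fun_ler.
transitivity (P [set w | (0 <= G w) && B (G w, V w)]).
  apply: probability_ae_eq => //; first exact: measurable_and.
  by apply: filterS G0 => w ->.
rewrite (probability_independent_pair
  (B := fun z : R * T2 => (0 <= z.1) && B z) mG mV)//; last first.
  by apply: measurable_and => //; exact: measurable_fun_ler.
transitivity (\int[P]_w ((0 <= G w)%R%:R *
    ((p * Num.max (G w) 0 + q) * expR (- mu * G w)))%:E)%E.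
  apply: eq_integral => w _ /=; have [g0|g0] := leP 0 (G w).
    by rewrite mul1r PB// max_l.
  rewrite mul0r; apply: etrans (measure0 P).
  by congr (P _); apply/seteqP; split.
apply: etrans (expectation_gap rate_gt0 mu_gt0 mX iidX Dm k p0 q0).
apply: integral_ae_true => //; first by solve_measurable.
move=> w; rewrite mulr_ge0 ?expR_ge0// addr_ge0// mulr_ge0//.
by rewrite le_max lexx orbT.
Qed.

End gap_mixture.

(** * Overlap events in terms of the gap and the service times *)

Section overlap_algebra.
Context (R : realType).
Implicit Types s t a b c e g x y : R.

Lemma lt_first_overlap s t a c x : 0 <= x -> 0 <= t - s ->
  (x < Num.max (Num.min (s + a) (t + c) - Num.max s t) 0) =
  ((t - s + x < a) && (x < c)).
Proof.
move=> x0; rewrite subr_ge0 => st.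
rewrite lt_max (ltNge x 0) x0 orbF max_r// ltrBrDr lt_min.
by congr (_ && _); lra.
Qed.

Lemma lt_second_overlap s t a b c e y : 0 <= y ->
  (y < Num.max (Num.min (s + (a + b)) (t + (c + e))
                - Num.max (s + a) (t + c)) 0) =
  ((y + Num.max (t - s + c - a) 0 < b)
   && (y + Num.max (a - (t - s) - c) 0 < e)).
Proof.
move=> y0.
rewrite lt_max (ltNge y 0) y0 orbF ltrBrDr lt_min !addr_maxr !gt_max.
by apply/idP/idP => /andP[/andP[h1 h2] /andP[h3 h4]];
  (apply/andP; split; apply/andP; split); lra.
Qed.

End overlap_algebra.

(** * The tandem queue *)

Section tandem.
Context (d : measure_display) (T : measurableType d) (R : realType)
  (P : probability T R) (lambda mu : R)
  (A : nat -> {RV P >-> R}) (S : nat -> nat -> {RV P >-> R}) (n k : nat).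
Hypotheses (lambda_gt0 : 0 < lambda) (mu_gt0 : 0 < mu)
  (n_ge1 : (1 <= n)%N) (k_ge1 : (1 <= k)%N)
  (queue : MMinf_tandem2 lambda mu A S).

Let a : T -> R := S 1 n.
Let b : T -> R := S 2 n.
Let c : T -> R := S 1 (n + k).
Let e : T -> R := S 2 (n + k).
(* With customers numbered from 1, the index n >= 1 keeps the sum away from
   [interarrival A 0], the time to the first arrival. *)
Let gap w := \sum_(n <= i < n + k) interarrival A i w.

Let gapE w : gap w = A (n + k)%N w - A n w.
Proof.
rewrite /gap -(telescope_sumr (fun i => A i w) (leq_addr k n)).
rewrite [LHS]big_nat [RHS]big_nat; apply: eq_bigr => -[|i] /andP[ni _] //.
by move: n_ge1; rewrite ltnNge ni.
Qed.

Let mS j i : measurable_fun setT (S j i).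
Proof. exact: measurable_funPT. Qed.

Let mA i : measurable_fun setT (A i).
Proof. exact: measurable_funPT. Qed.

Let mX i : measurable_fun setT (interarrival A i).
Proof.
case: i => [|i]; last by apply: measurable_funB; exact: mA.
by apply: measurable_funB; [exact: mA|exact: measurable_cst].
Qed.

Let St (ji : nat * nat) : T -> R := S ji.1 ji.2.
Let mSt ji : stations_customers ji -> measurable_fun setT (St ji).
Proof. by move=> _; exact: mS. Qed.

Let independent_service d' (T' : measurableType d') (J : set (nat * nat))
    (V : T -> T') ji : J `<=` stations_customers -> stations_customers ji ->
  ~ J ji -> measurable_fun (setT : set (sigma_familyType St J)) V ->
  independent_pair P V (St ji).
Proof.
move=> JD Dji Jji mV E F mE mF.
apply: (mutually_independent_rest (tandem_services queue).1 mSt JD) => //.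
exact: sigma_family_preimage.
Qed.

Let station_customer j i : (1 <= j <= 2)%N -> i = n \/ i = (n + k)%N ->
  stations_customers (j, i).
Proof.
by move=> j12 [->|->]; split => //=; rewrite /customers/= addn_gt0 n_ge1.
Qed.

Let neq_nk : n <> (n + k)%N.
Proof.
by move/eqP; rewrite -[X in X == _]addn0 eqn_add2l eq_sym -leqn0 leqNgt k_ge1.
Qed.

(* Each service time is independent of those that will be integrated out after
   it. *)
Let ind_ca : independent_pair P c a.
Proof.
apply: (independent_service (J := [set (1, n + k)%N]) (ji := (1, n)%N)).
- by move=> _ ->; apply: station_customer => //; right.
- by apply: station_customer => //; left.
- by case=> /neq_nk.
- by apply: (@measurable_sigma_family _ _ _ _ St _ (1, n + k)%N).
Qed.

Let ind_cab : independent_pair P (fun w => (c w, a w)) b.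
Proof.
pose J := [set ji | ji = (1, n + k)%N \/ ji = (1, n)%N].
apply: (independent_service (J := J) (ji := (2, n)%N)).
- by move=> _ [] ->; apply: station_customer => //; [right|left].
- by apply: station_customer => //; left.
- by case.
- apply: measurable_fun_pair.
    by apply: (@measurable_sigma_family _ _ _ _ St _ (1, n + k)%N); left.
  by apply: (@measurable_sigma_family _ _ _ _ St _ (1, n)%N); right.
Qed.

Let ind_cabe : independent_pair P (fun w => (c w, a w, b w)) e.
Proof.
pose J := [set ji | [\/ ji = (1, n + k)%N, ji = (1, n)%N | ji = (2, n)%N]].
apply: (independent_service (J := J) (ji := (2, n + k)%N)).
- by move=> _ [] ->; apply: station_customer => //; [right|left|left].
- by apply: station_customer => //; right.
- by case=> // -[] /esym/neq_nk.
- apply: measurable_fun_pair; first apply: measurable_fun_pair.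
  + by apply: (@measurable_sigma_family _ _ _ _ St _ (1, n + k)%N); apply: Or31.
  + by apply: (@measurable_sigma_family _ _ _ _ St _ (1, n)%N); apply: Or32.
  + by apply: (@measurable_sigma_family _ _ _ _ St _ (2, n)%N); apply: Or33.
Qed.

Let V w := (c w, a w, b w, e w).

Let mV : measurable_fun setT V.
Proof. by rewrite /V; solve_measurable; exact: mS. Qed.

Let ind_gapV : independent_pair P gap V.
Proof.
move=> E F mE mF; apply: (tandem_independent queue).
  apply: sigma_family_preimage => //.
  rewrite (_ : gap = fun w => A (n + k)%N w - A n w); last exact/funext/gapE.
  apply: measurable_funB.
    apply: (@measurable_sigma_family _ _ _ _ (fun i => A i : T -> R)
      customers (n + k)%N).
    by rewrite /customers/= addn_gt0 n_ge1.
  exact: (@measurable_sigma_family _ _ _ _ (fun i => A i : T -> R) customers n).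
apply: sigma_family_preimage => //.
by rewrite /V; do !apply: measurable_fun_pair;
 [apply: (@measurable_sigma_family _ _ _ _ St _ (1, n + k)%N)
 |apply: (@measurable_sigma_family _ _ _ _ St _ (1, n)%N)
 |apply: (@measurable_sigma_family _ _ _ _ St _ (2, n)%N)
 |apply: (@measurable_sigma_family _ _ _ _ St _ (2, n + k)%N)];
 apply: station_customer => //; [right|left|left|right].
Qed.

Let exps j i : (1 <= j <= 2)%N -> i = n \/ i = (n + k)%N ->
  exponential_law P mu (S j i).
Proof.
move=> j12 ink.
exact: ((tandem_services queue).2 (j, i) (station_customer j12 ink)).
Qed.

Let exp_a : exponential_law P mu a. Proof. by apply: exps => //; left. Qed.
Let exp_b : exponential_law P mu b. Proof. by apply: exps => //; left. Qed.
Let exp_c : exponential_law P mu c. Proof. by apply: exps => //; right. Qed.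
Let exp_e : exponential_law P mu e. Proof. by apply: exps => //; right. Qed.

Let overlap1E w x : 0 <= x -> 0 <= gap w ->
  (x < overlap A S 1 n (n + k) w) = (gap w + x < a w) && (x < c w).
Proof.
rewrite gapE => x0 G0.
rewrite /overlap /departure /= !big_nat1 !big_geq// !addr0.
exact: lt_first_overlap.
Qed.

Let overlap2E w y : 0 <= y ->
  (y < overlap A S 2 n (n + k) w) =
  (y + Num.max (gap w + c w - a w) 0 < b w) &&
  (y + Num.max (a w - gap w - c w) 0 < e w).
Proof.
rewrite gapE => y0.
rewrite /overlap /departure /= ![\sum_(1 <= l < 3) _]big_nat_recr//= !big_nat1.
exact: lt_second_overlap.
Qed.

Let first_event (x : R) (z : R * (R * R * R * R)) :=
  (z.1 + x < z.2.1.1.2) && (x < z.2.1.1.1).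
Let second_event (y : R) (z : R * (R * R * R * R)) :=
  (y + Num.max (z.1 + z.2.1.1.1 - z.2.1.1.2) 0 < z.2.1.2) &&
  (y + Num.max (z.2.1.1.2 - z.1 - z.2.1.1.1) 0 < z.2.2).

Let measurable_first x : measurable_fun setT (first_event x).
Proof. by apply: measurable_and; solve_measurable. Qed.

Let measurable_second_event y : measurable_fun setT (second_event y).
Proof. by apply: measurable_and; solve_measurable. Qed.

Let mgap : measurable_fun setT gap.
Proof.
exact: (measurable_gap (D := setT) (fun i _ => mX i) (fun _ _ => I)).
Qed.

Let gap0 : {ae P, forall w, 0 <= gap w}.
Proof.
exact: (gap_ge0 lambda_gt0 (fun i _ => mX i) (tandem_arrivals queue)
  (fun _ _ => I)).
Qed.

Let mixture := probability_gap_mixture lambda_gt0 mu_gt0 (fun i _ => mX i)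
  (tandem_arrivals queue) (fun _ _ => I) mV ind_gapV.

Let mgapV : measurable_fun setT (fun w => (gap w, V w)).
Proof. exact: measurable_fun_pair. Qed.

Let alpha := lambda / (lambda + mu).

Lemma measurable_overlap j : measurable_fun setT (overlap A S j n (n + k)).
Proof.
have mdep l i : measurable_fun setT (departure A S l i).
  apply: measurable_funD; first exact: mA.
  by apply: measurable_sum => ?; exact: mS.
by apply: measurable_maxr => //; apply: measurable_funB;
  [apply: measurable_minr|apply: measurable_maxr]; exact: mdep.
Qed.

Lemma probability_overlap1 x : 0 <= x ->
  P [set w | x < overlap A S 1 n (n + k) w] =
  (expR (- 2 * mu * x) * alpha ^+ k)%:E.
Proof.
move=> x0.
transitivity (P [set w | first_event x (gap w, V w)]).
  apply: probability_ae_eq.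
  - by apply: measurable_fun_ltr => //; exact: measurable_overlap.
  - exact: (measurableT_comp (measurable_first x) mgapV).
  - by apply: filterS gap0 => w Gw; exact: overlap1E.
rewrite (mixture (p := 0) (q := expR (- 2 * mu * x)))//.
- by congr EFin; rewrite mulr0 mul0r addr0 mulrC.
- by move=> g g0; rewrite /first_event/=
    (probability_both_exceed mu_gt0 _ _ exp_a exp_c ind_ca) ?addr_ge0//;
    congr EFin; rewrite -!expRD mul0r add0r -expRD; congr expR; ring.
Qed.

Lemma probability_overlap2 y : 0 <= y ->
  P [set w | y < overlap A S 2 n (n + k) w] =
  (expR (- 2 * mu * y) / 2 * alpha ^+ k
   * (1 + k%:R * (mu / (lambda + mu))))%:E.
Proof.
move=> y0.
transitivity (P [set w | second_event y (gap w, V w)]).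
  by congr (P _); apply/funext => w /=; rewrite overlap2E.
pose K := expR (- 2 * mu * y).
rewrite (mixture (p := K * mu / 2) (q := K / 2))//.
- congr EFin; rewrite /K /alpha; field.
  by rewrite gt_eqF// addr_gt0.
- by rewrite !mulr_ge0 ?expR_ge0// ltW.
- by rewrite divr_ge0 ?expR_ge0.
move=> g g0; rewrite /second_event/=.
(* The constraints 0 < a and 0 < c hold almost surely; they bring the event
   into the form with s = r = 0. *)
transitivity (P [set v | [&& 0 < a v, 0 < c v,
    y + Num.max (g + c v - a v) 0 < b v
  & y + Num.max (a v - g - c v) 0 < e v]]).
  apply: probability_ae_eq.
  - by apply: measurable_and; solve_measurable; exact: mS.
  - by do 3 (apply: measurable_and; first (solve_measurable; exact: mS));
      solve_measurable; exact: mS.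
  - have a0 := exponential_law_gt0 mu_gt0 (mS 1 n) exp_a.
    have c0 := exponential_law_gt0 mu_gt0 (mS 1 (n + k)%N) exp_c.
    by apply: filterS2 a0 c0 => w aw cw; rewrite aw cw.
rewrite (probability_second_overlap mu_gt0 _ _ _ _ exp_a exp_b exp_c exp_e
  ind_ca ind_cab ind_cabe)// ?addr0//.
by congr EFin; rewrite mulr0 expR0 subr0 -/K; field.
Qed.

Lemma probability_overlap12 x y : 0 <= x -> 0 <= y ->
  P [set w | (x < overlap A S 1 n (n + k) w)
             && (y < overlap A S 2 n (n + k) w)] =
  (expR (- 2 * mu * (x + y)) / 2 * alpha ^+ k)%:E.
Proof.
move=> x0 y0.
transitivity (P [set w | first_event x (gap w, V w)
                         && second_event y (gap w, V w)]).
  apply: probability_ae_eq.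
  - apply: measurable_and; apply: measurable_fun_ltr => //;
      exact: measurable_overlap.
  - apply: measurable_and.
      exact: (measurableT_comp (measurable_first x) mgapV).
    exact: (measurableT_comp (measurable_second_event y) mgapV).
  - by apply: filterS gap0 => w Gw; rewrite overlap1E// overlap2E.
rewrite (mixture (B := fun z => first_event x z && second_event y z) (p := 0)
  (q := expR (- 2 * mu * (x + y)) / 2))//.
- by congr EFin; rewrite mulr0 mul0r addr0 mulrC.
- exact: measurable_and.
move=> g g0; rewrite /first_event /second_event/=.
under eq_set => v do rewrite -!andbA.
(* Here s = g + x and r = x, so that g + r - s = 0. *)
rewrite (probability_second_overlap mu_gt0 _ _ _ _ exp_a exp_b exp_c exp_e
  ind_ca ind_cab ind_cabe)// ?addr_ge0//.
congr EFin; rewrite subrr mulr0 addr0 mul0r add0r mul1r.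
rewrite (_ : - 2 * mu * (x + y) = - 2 * mu * y + - 2 * mu * x); last by ring.
by rewrite expRD; ring.
Qed.

End tandem.

Theorem theorem3p2 (d : measure_display) (T : measurableType d) (R : realType)
    (P : probability T R) (lambda mu : R)
    (A : nat -> {RV P >-> R}) (S : nat -> nat -> {RV P >-> R}) (n k : nat)
    (lambda_gt0 : 0 < lambda) (mu_gt0 : 0 < mu)
    (n_ge1 : (1 <= n)%N) (k_ge1 : (1 <= k)%N)
    (queue : MMinf_tandem2 lambda mu A S) :
  let alpha := lambda / (lambda + mu) in
  let O1 := overlap A S 1 n (n + k) in
  let O2 := overlap A S 2 n (n + k) in
  forall x y : R, 0 <= x -> 0 <= y ->
  [/\ P [set w | x < O1 w] = (expR (- 2 * mu * x) * alpha ^+ k)%:E,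
      P [set w | y < O2 w] =
        (expR (- 2 * mu * y) / 2 * alpha ^+ k
         + expR (- 2 * mu * y) / 2 * alpha ^+ k
           * (mu / (lambda + mu)) * k%:R)%:E,
      P [set w | O1 w <= x /\ O2 w <= y] =
        (1 - (expR (- 2 * mu * y) / 2
              + expR (- 2 * mu * y) / 2 * (mu * k%:R / (lambda + mu))
              - expR (- 2 * mu * (x + y)) / 2
              + expR (- 2 * mu * x)) * alpha ^+ k)%:E,
      P [set w | O1 w <= x /\ y < O2 w] =
        ((expR (- 2 * mu * y) / 2
          + expR (- 2 * mu * y) / 2 * (mu / (lambda + mu)) * k%:R
          - expR (- 2 * mu * (x + y)) / 2) * alpha ^+ k)%:E &
      P [set w | x < O1 w /\ O2 w <= y] =
        ((expR (- 2 * mu * x) - expR (- 2 * mu * (x + y)) / 2)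
         * alpha ^+ k)%:E].
Proof.
move=> alpha O1 O2 x y x0 y0.
pose E1 := [set w | x < O1 w]; pose E2 := [set w | y < O2 w].
have mE j z : measurable [set w | z < overlap A S j n (n + k) w].
  rewrite -[X in measurable X]setTI.
  have := measurable_fun_ltr (measurable_cst z) (measurable_overlap A S n k j).
  by move=> /(_ measurableT [set true]); exact.
have mE1 : measurable E1 := mE 1 x.
have mE2 : measurable E2 := mE 2 y.
have P1 := probability_overlap1 lambda_gt0 mu_gt0 n_ge1 k_ge1 queue x0.
have P2 := probability_overlap2 lambda_gt0 mu_gt0 n_ge1 k_ge1 queue y0.
have P12 : P (E1 `&` E2) = (expR (- 2 * mu * (x + y)) / 2 * alpha ^+ k)%:E.
  rewrite -(probability_overlap12 lambda_gt0 mu_gt0 n_ge1 k_ge1 queue x0 y0).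
  by congr (P _); apply/seteqP; split => w /=; [case=> -> ->|move/andP].
have fin (F : set T) : measurable F -> (P F < +oo)%E.
  by move=> mF; rewrite -ge0_fin_numE ?fin_num_measure.
have PD2 : P (E2 `\` E1) = (expR (- 2 * mu * y) / 2 * alpha ^+ k
    * (1 + k%:R * (mu / (lambda + mu)))
    - expR (- 2 * mu * (x + y)) / 2 * alpha ^+ k)%:E.
  by rewrite measureD ?fin// EFinB -P12 setIC -P2.
have le_gt (u v : R) : (u <= v) = (~ (v < u : bool)) :> Prop.
  by rewrite leNgt; apply/propext; split => /negP.
split.
- exact: P1.
- by rewrite P2; congr EFin; ring.
- rewrite (_ : [set w | _ /\ _] = ~` E1 `\` E2); last first.
    by apply/seteqP; split => w; rewrite /= !le_gt.
  have mE1C : measurable (~` E1) by exact: measurableC.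
  rewrite measureD ?fin//.
  rewrite setIC -setDE [X in (_ - X)%E]PD2.
  rewrite [X in (X - _)%E](probability_setC P)//.
  by rewrite [P E1]P1 -!EFinB; congr EFin; ring.
- rewrite (_ : [set w | _ /\ _] = E2 `\` E1); last first.
    by apply/seteqP; split => w; rewrite /= le_gt => -[].
  by rewrite PD2; congr EFin; ring.
- rewrite (_ : [set w | _ /\ _] = E1 `\` E2); last first.
    by apply/seteqP; split => w; rewrite /= le_gt.
  rewrite measureD ?fin// [X in (_ - X)%E]P12 [X in (X - _)%E]P1 -EFinB.
  by congr EFin; ring.
Qed.
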